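(* Let $\dot A$ be a densely defined closed symmetric operator with deficiency indices $(1,1)$ in a Hilbert space $\mathcal H$, with $(+)$-normalized deficiency vectors $g_\pm\in\operatorname{Ker}(\dot A^*\mp iI)$. Let $\Theta$ be an L-system with symmetric operator $\dot A$, main operator $T\neq T^*$ (a maximal dissipative extension of $\dot A$) and quasi-kernel $\hat A$ of $\operatorname{Re}\mathbb A$, such that $g_+\in\operatorname{Dom}(T)$ (i.e. the von Neumann parameter of $T$ is $\kappa=0$) and either $g_+-g_-\in\operatorname{Dom}(\hat A)$ or $g_++g_-\in\operatorname{Dom}(\hat A)$. Then for every real $Q\neq 0$ the dissipation coefficient $\mathcal D(Q)$ of the perturbed L-system $\Theta(Q)$ is $$\mathcal D(Q)=\frac{4}{Q^2+4}.$$
   Context: Rigged space: for a densely defined closed symmetric operator $\dot A$ in $\mathcal H$, let $\mathcal H_+=\operatorname{Dom}(\dot A^* )$ with inner product $(f,g)_+=(f,g)+(\dot A^*f,\dot A^*g)$, and let $\mathcal H_-$ be its dual, giving $\mathcal H_+\subset\mathcal H\subset\mathcal H_-$. $[\mathcal H_1,\mathcal H_2]$ denotes bounded linear operators from $\mathcal H_1$ to $\mathcal H_2$. If $\mathbb A\in[\mathcal H_+,\mathcal H_-]$ then $\mathbb A^*\in[\mathcal H_+,\mathcal H_-]$; put $\operatorname{Re}\mathbb A=\frac12(\mathbb A+\mathbb A^* )$, $\operatorname{Im}\mathbb A=\frac1{2i}(\mathbb A-\mathbb A^* )$. ''$(+)$-normalized'' means $\|g_\pm\|_+=1$ (note $\|g_\pm\|_+^2=2\|g_\pm\|^2$);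 ''$(\cdot)$-normalized'' means unit norm in $\mathcal H$. An operator $T$ is dissipative if $\operatorname{Im}(Tf,f)\ge 0$ for all $f\in\operatorname{Dom}(T)$. $( * )$-extension: for $T$ with $\dot A\subset T\subset\dot A^*$, an operator $\mathbb A\in[\mathcal H_+,\mathcal H_-]$ is a $( * )$-extension of $T$ if $\dot A\subset T\subset\mathbb A$, $\dot A\subset T^*\subset\mathbb A^*$ and the quasi-kernel $\hat A$ of $\operatorname{Re}\mathbb A$, i.e. the restriction of $\operatorname{Re}\mathbb A$ to $\{f\in\mathcal H_+:(\operatorname{Re}\mathbb A)f\in\mathcal H\}$, is a self-adjoint extension of $\dot A$ in $\mathcal H$. L-system: given $\dot A$ with deficiency indices $(1,1)$ and a dissipative $T$ with $\dot A\subset T\subset\dot A^*$, an L-system $\Theta$ with symmetric operator $\dot A$ and main operator $T$ consists of the rigged space above, a $( * )$-extension $\mathbb A$ of $T$ (the state-space operator), and $K\in[\mathbb C,\mathcal H_-]$ with $K^*\in[\mathcal H_+,\mathbb C]$ and $\operatorname{Im}\mathbb A=KK^*$. Its transfer function is $W_\Theta(z)=I-2iK^*(\mathbb A-zI)^{-1}K$, $z\in\rho(T)$, and its impedance function is $V_\Theta(z)=K^*(\operatorname{Re}\mathbb A-zI)^{-1}K$; for $z\in\rho(T)$, $\operatorname{Im}z\ne0$, they are related by $V_\Theta(z)=i[W_\Theta(z)+I]^{-1}[W_\Theta(z)-I]$ and $W_\Theta(z)=(I+iV_\Theta(z))^{-1}(I-iV_\Theta(z))$. Von Neumann parameter: $\kappa$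 is the von Neumann parameter of $T$ with respect to a deficiency basis $g_\pm$ (vectors of equal norm in $\operatorname{Ker}(\dot A^*\mp iI)$) if $g_+-\kappa g_-\in\operatorname{Dom}(T)$. Perturbation: for $Q\in\mathbb R\setminus\{0\}$, the perturbed L-system $\Theta(Q)$ (the perturbation of $\Theta$) is an L-system with the same symmetric operator $\dot A$ as $\Theta$ whose impedance function satisfies the impedance shift formula $V_{\Theta(Q)}(z)=Q+V_\Theta(z)$. Dissipation coefficient: let $T$ be the main operator of an L-system and let $g'_\pm\in\operatorname{Ker}(\dot A^*\mp iI)$ be a $(\cdot)$-normalized deficiency basis with respect to which the von Neumann parameter $\kappa$ of $T$ satisfies $0\le\kappa\le1$. With $\tilde y=g'_+-\kappa g'_-$, the dissipation coefficient of the L-system is $\mathcal D=\operatorname{Im}(T\tilde y,\tilde y)$. *)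

(* Defs.v *)
From mathcomp Require Export all_boot all_order all_algebra.
From mathcomp Require Export sesquilinear complex.
From mathcomp Require Export all_classical all_reals all_analysis.
Export numFieldNormedType.Exports.
Export Order.TTheory GRing.Theory Num.Theory.

Set Implicit Arguments.
Unset Strict Implicit.
Unset Printing Implicit Defensive.

Local Open Scope classical_set_scope.
Local Open Scope ring_scope.

(* A complex Hilbert space: a Banach space over R[i] whose norm comes from an
   inner product.  A form of type {dot _ for conjC} is linear in its first
   argument, conjugate-linear in its second one, and positive definite. *)
Record hilbertSpace (R : realType) := HilbertSpace {
  hilbert_sort :> completeNormedModType R[i];
  inner : {dot hilbert_sort for @Num.conj R[i]};
  inner_norm : forall f : hilbert_sort, inner f f = `|f| ^+ 2
}.

Section Operators.
Context {R : realType} {H : hilbertSpace R}.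
Local Notation C := R[i].
Local Notation "''(' f , g )" := (inner H f g) (format "''(' f ,  g )").

(* Unbounded operators.  The values of [app] outside [dom] are irrelevant, so
   operators are compared with [extends] and [opeq], never with Leibniz
   equality. *)
Record operator := Operator { dom : set H; app :> H -> H }.

Definition linear_operator (T : operator) : Prop :=
  dom T 0 /\
  forall (a : C) (f g : H), dom T f -> dom T g ->
    dom T (a *: f + g) /\ T (a *: f + g) = a *: T f + T g.

Definition extends (S T : operator) : Prop :=
  forall f, dom S f -> dom T f /\ T f = S f.

Definition opeq (S T : operator) : Prop := extends S T /\ extends T S.

Definition densely_defined (T : operator) : Prop := dense (dom T).

Definition closed_operator (T : operator) : Prop :=
  closed [set p : H * H | dom T p.1 /\ T p.1 = p.2].

Definition adjoint_value (T : operator) (g h : H) : Prop :=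
  forall f, dom T f -> '(T f, g) = '(f, h).

(* [h] is unique when [T] is densely defined. *)
Definition adjoint (T : operator) : operator :=
  Operator [set g | exists h, adjoint_value T g h]
           (fun g => xget 0 [set h | adjoint_value T g h]).

Definition symmetric_operator (T : operator) : Prop := extends T (adjoint T).

Definition self_adjoint (T : operator) : Prop :=
  [/\ linear_operator T, densely_defined T & opeq T (adjoint T)].

Definition dissipative (T : operator) : Prop :=
  forall f, dom T f -> 0 <= complex.Im '(T f, f).

Definition maximal_dissipative (T : operator) : Prop :=
  dissipative T /\
  forall S, linear_operator S -> dissipative S -> extends T S -> opeq S T.

(* Ker (A - z I) *)
Definition eigenspace (A : operator) (z : C) : set H :=
  [set f | dom A f /\ A f = z *: f].

Definition has_dim (V : set H) (n : nat) : Prop :=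
  exists b : 'I_n -> H,
    (forall c : 'I_n -> C, \sum_i c i *: b i = 0 -> forall i, c i = 0) /\
    V = [set v | exists c : 'I_n -> C, v = \sum_i c i *: b i].

Definition deficiency_indices (A : operator) (m n : nat) : Prop :=
  has_dim (eigenspace (adjoint A) 'i) m /\
  has_dim (eigenspace (adjoint A) (- 'i)) n.

(* The rigged space H_+ c H c H_- attached to a densely defined [A]: H_+ is
   Dom (A^* ) and H_- is the space of bounded antilinear functionals on H_+.
   Elements of H_- are functions on the whole of [H], of which only the values
   on H_+ matter; [h : H] is the functional (h, .).  An operator B from H_+ to
   H_- is a function [B : H -> H -> C], [B f g] being the value of the
   functional B f at g. *)
Section RiggedSpace.
Variable A : operator.

Definition Hplus : set H := dom (adjoint A).

Definition inner_plus (f g : H) : C :=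
  '(f, g) + '(adjoint A f, adjoint A g).

Definition norm_plus (f : H) : C := sqrtC (inner_plus f f).

Definition eq_Hminus (F G : H -> C) : Prop := forall g, Hplus g -> F g = G g.

Definition emb_Hminus (h : H) : H -> C := fun g => '(h, g).

Definition Hminus : set (H -> C) :=
  [set F | (forall (a : C) (f g : H), Hplus f -> Hplus g ->
              F (a *: f + g) = a^* * F f + F g) /\
           exists M : R, forall f, Hplus f ->
              `|F f| <= (M%:C)%C * norm_plus f].

(* [H_+, H_-] *)
Definition bounded_plus_minus (B : H -> H -> C) : Prop :=
  [/\ forall f, Hplus f -> Hminus (B f),
      forall (a : C) (f g : H), Hplus f -> Hplus g ->
        eq_Hminus (B (a *: f + g)) (fun h => a * B f h + B g h)
    & exists M : R, forall f g, Hplus f -> Hplus g ->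
        `|B f g| <= (M%:C)%C * norm_plus f * norm_plus g].

(* [C, H_-] *)
Definition bounded_C_minus (K : C -> H -> C) : Prop :=
  [/\ forall c, Hminus (K c),
      forall a c d : C, eq_Hminus (K (a * c + d)) (fun h => a * K c h + K d h)
    & exists M : R, forall c f, Hplus f ->
        `|K c f| <= (M%:C)%C * `|c| * norm_plus f].

(* <B^* f, g> is the conjugate of <B g, f> *)
Definition rigged_adjoint (B : H -> H -> C) : H -> H -> C :=
  fun f g => (B g f)^*.

(* K^* : H_+ -> C is determined by <K c, f> = c * (K^* f)^*. *)
Definition channel_adjoint (K : C -> H -> C) : H -> C := fun f => (K 1 f)^*.

Definition rigged_Re (B : H -> H -> C) : H -> H -> C :=
  fun f g => 2^-1 * (B f g + rigged_adjoint B f g).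

Definition rigged_Im (B : H -> H -> C) : H -> H -> C :=
  fun f g => (2 * 'i)^-1 * (B f g - rigged_adjoint B f g).

(* T c B, for T acting in H and B from H_+ to H_- *)
Definition rigged_extends (T : operator) (B : H -> H -> C) : Prop :=
  forall f, dom T f -> Hplus f /\ eq_Hminus (B f) (emb_Hminus (T f)).

(* The restriction of B to {f in H_+ : B f in H}; the value in [H] is unique
   because H_+ is dense. *)
Definition quasi_kernel (B : H -> H -> C) : operator :=
  Operator
    [set f | Hplus f /\ exists h : H, eq_Hminus (B f) (emb_Hminus h)]
    (fun f => xget 0 [set h | eq_Hminus (B f) (emb_Hminus h)]).

Definition star_extension (T : operator) (B : H -> H -> C) : Prop :=
  [/\ bounded_plus_minus B,
      extends A T /\ rigged_extends T B,
      extends A (adjoint T) /\ rigged_extends (adjoint T) (rigged_adjoint B)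
    & self_adjoint (quasi_kernel (rigged_Re B)) /\
      extends A (quasi_kernel (rigged_Re B))].

(* (B - z I)^{-1} F : the f in H_+ such that (B - z I) f = F in H_-. *)
Definition rigged_resolvent (B : H -> H -> C) (z : C) (F : H -> C) : H :=
  xget 0 [set f | Hplus f /\ eq_Hminus (fun g => B f g - z * '(f, g)) F].

Record Lsystem := MkLsystem {
  main_op : operator;
  state_op : H -> H -> C;
  channel_op : C -> H -> C;
  main_linear : linear_operator main_op;
  main_dissipative : dissipative main_op;
  main_between : extends A main_op /\ extends main_op (adjoint A);
  state_star_extension : star_extension main_op state_op;
  channel_bounded : bounded_C_minus channel_op;
  state_Im : forall f, Hplus f ->
    eq_Hminus (rigged_Im state_op f) (channel_op (channel_adjoint channel_op f))
}.

(* V(z) = K^* (Re B - z I)^{-1} K, an operator on C identified with its value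
   at 1. *)
Definition impedance (Theta : Lsystem) (z : C) : C :=
  channel_adjoint (channel_op Theta)
    (rigged_resolvent (rigged_Re (state_op Theta)) z (channel_op Theta 1)).

Definition state_quasi_kernel (Theta : Lsystem) : operator :=
  quasi_kernel (rigged_Re (state_op Theta)).

Definition perturbation (Theta : Lsystem) (Q : R) (ThetaQ : Lsystem) : Prop :=
  forall z : C, complex.Im z != 0 ->
    impedance ThetaQ z = (Q%:C)%C + impedance Theta z.

Definition deficiency_vectors (gp gm : H) : Prop :=
  eigenspace (adjoint A) 'i gp /\ eigenspace (adjoint A) (- 'i) gm.

Definition vonNeumann_parameter (T : operator) (gp gm : H) (kappa : C) : Prop :=
  [/\ deficiency_vectors gp gm, gp != 0, `|gp| = `|gm|
    & dom T (gp - kappa *: gm)].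

Definition dissipation_coefficient (Theta : Lsystem) (D : R) : Prop :=
  exists (gp gm : H) (kappa : R),
    let y := gp - (kappa%:C)%C *: gm in
    [/\ `|gp| = 1 /\ `|gm| = 1,
        vonNeumann_parameter (main_op Theta) gp gm (kappa%:C)%C,
        0 <= kappa <= 1
      & D = complex.Im '(main_op Theta y, y)].

End RiggedSpace.
End Operators.

Arguments operator {R} H.

(* Main.v *)
Require Import Defs.
From mathcomp Require Import ring lra.

(* Let B be the state-space operator, S = Re B, chi = K 1 and phi = K^*, so that
   Im B f = phi(f) chi, and let f_z solve (S - z) f_z = chi; then V(z) = phi(f_z).
   Since phi vanishes on the domain of the symmetric operator, f_z lies in the
   deficiency space at z, and its squared norm is Im V(z) / Im z.
   If g_+ is in Dom(T), then f_i is a multiple of g_+ and V(i) = i, whatever the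
   quasi-kernel; hence V_Q(i) = Q + i and V_Q(-i) = Q - i, and the two resolvent
   vectors f, f' of the perturbed system form a normalized deficiency basis.  As
     B_Q f = i f + iQ chi   and   B_Q f' = - i f' + (2 + iQ) chi,
   a f + b f' can lie in Dom(T_Q) only if a iQ + b (2 + iQ) = 0.  By von
   Neumann's decomposition of Dom(A^* ) this line is indeed in Dom(T_Q), so
   kappa^2 = Q^2 / (Q^2 + 4), and the dissipation coefficient is 1 - kappa^2. *)

Set Implicit Arguments.
Unset Strict Implicit.
Unset Printing Implicit Defensive.

Local Open Scope classical_set_scope.
Local Open Scope ring_scope.

(** * Orthogonal projection *)

Lemma subrBB (V : zmodType) (x y z : V) : x - y - (x - z) = z - y.
Proof. by rewrite opprB addrCA addrAC subrr add0r. Qed.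

Section InnerProduct.
Context {R : realType} {H : hilbertSpace R}.
Local Notation C := R[i].
Local Notation "''(' f , g )" := (inner H f g) (format "''(' f ,  g )").
Implicit Types (f g h : H) (a : C).

Lemma innerC f g : ('(f, g))^* = '(g, f).
Proof. by rewrite [RHS]hermC expr0 mul1r. Qed.

Lemma innerDl f g h : '(f + g, h) = '(f, h) + '(g, h).
Proof. exact: linearDl. Qed.

Lemma innerDr f g h : '(h, f + g) = '(h, f) + '(h, g).
Proof. exact: linearDr. Qed.

Lemma innerNl f h : '(- f, h) = - '(f, h).
Proof. exact: linearNl. Qed.

Lemma innerNr f h : '(h, - f) = - '(h, f).
Proof. exact: linearNr. Qed.

Lemma innerZl a f h : '(a *: f, h) = a * '(f, h).
Proof. exact: linearZl_LR. Qed.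

Lemma innerZr a f h : '(h, a *: f) = a^* * '(h, f).
Proof. exact: linearZr_LR. Qed.

Lemma inner0l h : '(0, h) = 0.
Proof. exact: linear0l. Qed.

Lemma inner0r h : '(h, 0) = 0.
Proof. exact: linear0r. Qed.

Definition innerE :=
  (innerDl, innerDr, innerNl, innerNr, innerZl, innerZr, inner0l, inner0r).

Lemma inner_eq0 f : '(f, f) = 0 -> f = 0.
Proof. by rewrite inner_norm => /eqP; rewrite sqrf_eq0 normr_eq0 => /eqP. Qed.

(** The norm takes its values in [R[i]], where the order is partial; its real part gives access to
    infima, square roots and linear arithmetic in [R]. *)
Definition rnorm f : R := complex.Re `|f|.

Lemma rnormE f : `|f| = ((rnorm f)%:C)%C.
Proof. by rewrite RRe_real// normr_real. Qed.

Lemma rnorm_ge0 f : 0 <= rnorm f.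
Proof. by rewrite -ler0c -rnormE. Qed.

Lemma rnormD f g : rnorm (f + g) <= rnorm f + rnorm g.
Proof. by rewrite -lecR rmorphD/= -!rnormE ler_normD. Qed.

Lemma rnormN f : rnorm (- f) = rnorm f.
Proof. by rewrite /rnorm normrN. Qed.

Lemma rnormZ_nat n f : rnorm (n%:R *: f) = n%:R * rnorm f.
Proof.
by apply: complexI; rewrite rmorphM/= rmorph_nat -!rnormE normrZ normr_nat.
Qed.

Lemma rnorm_sqr f : '(f, f) = ((rnorm f ^+ 2)%:C)%C.
Proof. by rewrite inner_norm rnormE rmorphXn. Qed.

Lemma rnorm_parallelogram f g :
  rnorm (f + g) ^+ 2 + rnorm (f - g) ^+ 2 = 2 * (rnorm f ^+ 2 + rnorm g ^+ 2).
Proof.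
apply: complexI.
rewrite mulr_natl rmorphD/= rmorphMn/= rmorphD/= -!rnorm_sqr !innerE.
by ring.
Qed.

End InnerProduct.

Section OrthogonalProjection.
Context {R : realType} {H : hilbertSpace R}.
Local Notation C := R[i].
Local Notation "''(' f , g )" := (inner H f g) (format "''(' f ,  g )").

Lemma cauchy_cvg_rnorm (u : nat -> H) (b : nat -> R) : b @ \oo --> (0 : R) ->
  (forall m n, rnorm (u m - u n) ^+ 2 <= b m + b n) -> cvgn u.
Proof.
move=> b0 ub; apply: cauchy_cvg; apply: cauchy_exP => e e0.
have eE : e = ((complex.Re e)%:C)%C by rewrite RRe_real// gtr0_real.
have re0 : 0 < complex.Re e by rewrite -ltcR -eE.
have e20 : 0 < complex.Re e ^+ 2 / 2 by rewrite divr_gt0 ?exprn_gt0.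
have [N _ hN] : \forall n \near \oo, `|b n| < complex.Re e ^+ 2 / 2.
  by move/cvgr0Pnorm_lt : b0; apply.
exists (u N); exists N => // n /= Nn; rewrite -ball_normE/= rnormE eE ltcR.
rewrite -(@ltr_pXn2r _ 2)// ?nnegrE ?rnorm_ge0 ?ltW//.
apply: (le_lt_trans (ub N n)).
have := hN N (leqnn N); have := hN n Nn => /=.
by move=> /(le_lt_trans (ler_norm _)) ? /(le_lt_trans (ler_norm _)) ?; lra.
Qed.

Lemma nearest_orthogonal (M : set H) (e : H) :
  (forall (a : C) f, M f -> rnorm e <= rnorm (e - a *: f)) ->
  forall f, M f -> '(e, f) = 0.
Proof.
move=> emin f Mf.
have [->|f0] := eqVneq f 0; first by rewrite inner0r.
have ff : '(f, f) != 0 by apply: contra_neq f0; exact: inner_eq0.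
(* This is the coefficient of the projection of [e] on the line of [f]; subtracting that projection
   lowers the squared norm by [|(e, f)|^2 / (f, f)], which minimality forces to vanish. *)
have := emin ('(e, f) / '(f, f)) f Mf.
rewrite -(@ler_pXn2r _ 2)// ?nnegrE ?rnorm_ge0// -lecR -!rnorm_sqr !innerE.
rewrite rmorphM fmorphV/= !innerC.
set c := '(e, f).
have -> : '(e, e) - '(f, e) / '(f, f) * c + (- (c / '(f, f) * '(f, e)) -
     c / '(f, f) * - ('(f, e) / '(f, f) * '(f, f)))
   = '(e, e) - c * '(f, e) / '(f, f) by field.
rewrite -(innerC e f) -/c -normCK lerBrDr -lerBrDl subrr.
rewrite inner_norm pmulr_lle0 ?invr_gt0 ?exprn_gt0 ?normr_gt0// => h.
have /eqP : `|c| ^+ 2 = 0 by apply/le_anti; rewrite h exprn_ge0.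
by rewrite sqrf_eq0 normr_eq0 => /eqP.
Qed.

(** A minimizing sequence for the distance from [x] to [M] is Cauchy, its limit attains the
    distance, and a nearest point leaves an orthogonal remainder. *)
Theorem orthogonal_projection (M : set H) (x : H) : closed M -> M 0 ->
  (forall (a : C) f g, M f -> M g -> M (a *: f + g)) ->
  exists2 m, M m & forall f, M f -> '(x - m, f) = 0.
Proof.
move=> Mclosed M0 Mlin.
pose S := [set rnorm (x - m) ^+ 2 | m in M].
have infS : has_inf S.
  split; first by exists (rnorm (x - 0) ^+ 2); exists 0.
  by exists 0 => _ [m _ <-]; rewrite exprn_ge0 ?rnorm_ge0.
have dmin m : M m -> inf S <= rnorm (x - m) ^+ 2.
  by move=> Mm; apply: ge_inf; [exact: infS.2|exists m].
have d0 : 0 <= inf S.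
  apply: lb_le_inf; first exact: infS.1.
  by move=> _ [m _ <-]; rewrite exprn_ge0 ?rnorm_ge0.
have /choice[u hu] : forall n : nat, exists m,
    M m /\ rnorm (x - m) ^+ 2 < inf S + n.+1%:R^-1.
  move=> n; have [|_ [m Mm <-] hm] := @inf_adherent _ S n.+1%:R^-1 _ infS.
    by rewrite invr_gt0.
  by exists m.
have u_cvg : cvgn u.
  (* The midpoint of [u m] and [u n] lies in [M], so the parallelogram law bounds
     [rnorm (u m - u n) ^+ 2] by [2 / (m + 1) + 2 / (n + 1)]. *)
  apply: (@cauchy_cvg_rnorm u (fun n => 2 * n.+1%:R^-1)).
    rewrite -[X in _ --> X](mulr0 2); apply: cvgM; first exact: cvg_cst.
    exact: cvg_harmonic.
  move=> m n; have [Mm um] := hu m; have [Mn un] := hu n.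
  have := rnorm_parallelogram (x - u m) (x - u n).
  have -> : x - u m + (x - u n) = 2 *: (x - (2^-1 *: u m + 2^-1 *: u n)).
    rewrite scalerBr scalerDr !scalerA divff ?pnatr_eq0// !scale1r.
    by rewrite scaler_nat mulr2n addrACA opprD.
  have -> : x - u m - (x - u n) = u n - u m.
    exact: subrBB.
  rewrite -(opprB (u m)) rnormN rnormZ_nat.
  have /dmin : M (2^-1 *: u m + 2^-1 *: u n).
    by apply: (Mlin _ _ _ Mm); rewrite -[_ *: _]addr0; apply: Mlin.
  set w := x - _ => dw.
  move: um un dw.
  set A := rnorm (x - u m); set B := rnorm (x - u n); set E := rnorm (u m - _).
  rewrite exprMn -[2 ^+ 2]/(2 * 2).
  set a := m.+1%:R^-1; set b := n.+1%:R^-1.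
  by move: a b => a b *; lra.
move/cvg_ex : u_cvg => [l ul].
have Ml : M l.
  apply: (closed_cvg M Mclosed) ul.
  by apply: nearW => n; have [] := hu n.
exists l => //.
apply: nearest_orthogonal => a f Mf.
suff le_l : rnorm (x - l) ^+ 2 <= inf S.
  rewrite -(@ler_pXn2r _ 2)// ?nnegrE ?rnorm_ge0//.
  rewrite -addrA -opprD [l + _]addrC; apply: (le_trans le_l).
  exact/dmin/Mlin.
rewrite leNgt; apply/negP => lt_l.
set c := rnorm (x - l) in lt_l.
(* [b] is the root mean square of [c] and the infimal distance, hence strictly below [c]. For large
   [n], [u n] is within [c - b] of [l] and within [b] of [x], against the triangle inequality. *)
pose b := Num.sqrt ((inf S + c ^+ 2) / 2).
have c0 : 0 <= c by exact: rnorm_ge0.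
have b2 : b ^+ 2 = (inf S + c ^+ 2) / 2 by rewrite sqr_sqrtr//; nra.
have b0 : 0 <= b by exact: sqrtr_ge0.
have bc : b < c by rewrite -(@ltr_pXn2r _ 2)// ?nnegrE// b2; lra.
have near1 : \forall n \near \oo, rnorm (l - u n) < c - b.
  have e0 : 0 < ((c - b)%:C)%C by rewrite ltcR subr_gt0.
  move/cvgr_dist_lt : ul => /(_ _ e0); apply: filterS => n.
  by rewrite rnormE ltcR.
have near2 : \forall n \near \oo, n.+1%:R^-1 < (c ^+ 2 - inf S) / 2.
  have e0 : 0 < (c ^+ 2 - inf S) / 2 by lra.
  have /cvgr0Pnorm_lt/(_ _ e0) := @cvg_harmonic R.
  by apply: filterS => n /=; exact/le_lt_trans/ler_norm.
have [n [h1 h2]] := filter_ex (filterI near1 near2).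
have [_ h3] := hu n.
have h4 : rnorm (x - u n) < b.
  rewrite -(@ltr_pXn2r _ 2)// ?nnegrE ?rnorm_ge0//; apply: (lt_trans h3).
  suff -> : b ^+ 2 = inf S + (c ^+ 2 - inf S) / 2 by rewrite ltrD2l.
  by rewrite b2; field.
have := rnormD (x - u n) (- (l - u n)).
rewrite rnormN opprB addrA subrK -/c.
by move=> ?; lra.
Qed.

End OrthogonalProjection.

(** * Von Neumann's decomposition *)

Section Adjoint.
Context {R : realType} {H : hilbertSpace R}.
Local Notation C := R[i].
Local Notation "''(' f , g )" := (inner H f g) (format "''(' f ,  g )").
Implicit Types (A T : operator H) (f g h : H) (a : C).

Lemma linear_operator0 T : linear_operator T -> T 0 = 0.
Proof.
move=> [T0 linT]; have [_] := linT (-1) _ _ T0 T0.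
by rewrite !scaleN1r !addNr.
Qed.

Lemma linear_operatorZ T a f : linear_operator T -> dom T f ->
  dom T (a *: f) /\ T (a *: f) = a *: T f.
Proof.
move=> linT Tf; have := linT.2 a f 0 Tf linT.1.
by rewrite linear_operator0// !addr0.
Qed.

(** If [h] were nonzero, the ball of radius [|h|] around it would contain some [f] in [D]; but
    orthogonality gives [|h - f|^2 = |h|^2 + |f|^2], which is too large. *)
Lemma dense_orthogonal (D : set H) h :
  dense D -> (forall f, D f -> '(f, h) = 0) -> h = 0.
Proof.
move=> denseD orth; apply/eqP; apply: contrapT => /negP h0.
have h_gt0 : 0 < `|h| by rewrite normr_gt0.
have [||f [/= hf Df]] := denseD (ball h `|h|).
- by exists h; exact: ballxx.
- exact: ball_open.
move: hf; rewrite -ball_normE/= -(@ltr_pXn2r _ 2)// ?nnegrE// -!inner_norm.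
have hf : '(h, f) = 0 by rewrite -(innerC f) orth// rmorph0.
rewrite !innerE (orth f)// hf oppr0 addr0 add0r opprK gtrDl.
rewrite inner_norm => /(le_lt_trans (exprn_ge0 2 (normr_ge0 f))).
by rewrite ltxx.
Qed.

Lemma adjoint_value_eq T f g h : densely_defined T ->
  adjoint_value T f g -> adjoint_value T f h -> g = h.
Proof.
move=> denseT Tg Th; apply: subr0_eq.
apply: (dense_orthogonal denseT) => f' Tf'.
by rewrite !innerE -Tg// -Th// subrr.
Qed.

Lemma adjointE T g h : densely_defined T ->
  adjoint_value T g h -> dom (adjoint T) g /\ adjoint T g = h.
Proof.
move=> denseT Tgh; split; first by exists h.
apply: (adjoint_value_eq denseT) (Tgh).
exact: (@xgetPex _ 0 [set h | adjoint_value T g h] (ex_intro _ h Tgh)).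
Qed.

Lemma adjointP T f g :
  dom T f -> dom (adjoint T) g -> '(T f, g) = '(f, adjoint T g).
Proof.
move=> Tf [h Tgh].
exact: (@xgetPex _ 0 [set h | adjoint_value T g h] (ex_intro _ h Tgh)).
Qed.

Lemma adjoint_linear A : densely_defined A -> linear_operator (adjoint A).
Proof.
move=> denseA; split; first by exists 0 => f _; rewrite !inner0r.
move=> a f g Af Ag; apply: adjointE => // h Ah.
by rewrite !innerE !adjointP.
Qed.

End Adjoint.

Section VonNeumann.
Context {R : realType} {H : hilbertSpace R}.
Local Notation C := R[i].
Local Notation "''(' f , g )" := (inner H f g) (format "''(' f ,  g )").
Implicit Types (f g h : H) (a : C).

Lemma cvg_rnorm (u : nat -> H) (l : H) (b : nat -> R) : b @ \oo --> (0 : R) ->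
  (forall n, rnorm (l - u n) ^+ 2 <= b n) -> u @ \oo --> l.
Proof.
move=> b0 ub; apply/cvgrPdist_lt => e e0.
have eE : e = ((complex.Re e)%:C)%C by rewrite RRe_real// gtr0_real.
have re0 : 0 < complex.Re e by rewrite -ltcR -eE.
have e20 : 0 < complex.Re e ^+ 2 by rewrite exprn_gt0.
move/cvgr0Pnorm_lt : b0 => /(_ _ e20); apply: filterS => n bn.
rewrite rnormE eE ltcR -(@ltr_pXn2r _ 2)// ?nnegrE ?rnorm_ge0 ?ltW//.
by apply: (le_lt_trans (ub n)); apply: le_lt_trans bn; exact: ler_norm.
Qed.

Variable A : operator H.
Hypotheses (linA : linear_operator A) (denseA : densely_defined A).
Hypotheses (closedA : closed_operator A) (symA : symmetric_operator A).

Lemma symmetricE f g : dom A f -> dom A g -> '(A f, g) = '(f, A g).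
Proof. by move=> Af Ag; have [A'g <-] := symA Ag; exact: adjointP. Qed.

(** The cross terms cancel because [(A g, g)] is real. Thus the norm of [(A + i) g] is the graph
    norm of [g]. *)
Lemma rnorm_symmetric_addi g : dom A g ->
  rnorm (A g + 'i *: g) ^+ 2 = rnorm (A g) ^+ 2 + rnorm g ^+ 2.
Proof.
move=> Ag; apply: complexI.
rewrite rmorphD/= -!rnorm_sqr !innerE (symmetricE Ag Ag) conjCi.
by rewrite mulNr mulrA mulrN mulCii; ring.
Qed.

(** The orthogonal complement of this range is the deficiency space at [i]. *)
Definition range_addi : set H :=
  [set h | exists2 g, dom A g & h = A g + 'i *: g].

Lemma range_addi_linear a f g :
  range_addi f -> range_addi g -> range_addi (a *: f + g).
Proof.
move=> [f' Af ->] [g' Ag ->]; have [Afg AfgE] := linA.2 a _ _ Af Ag.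
exists (a *: f' + g') => //.
by rewrite AfgE !scalerDr addrACA !scalerA [a * _]mulrC.
Qed.

(** If [(A + i) g_n] converges, then [g_n] and [A g_n] are both Cauchy by [rnorm_symmetric_addi],
    and the closed graph of [A] contains the pair of limits. *)
Lemma closed_range_addi : closed range_addi.
Proof.
move=> u cu.
have /choice[g hg] : forall n : nat, exists g,
    dom A g /\ rnorm (u - (A g + 'i *: g)) ^+ 2 < n.+1%:R^-1.
  move=> n; pose e : R := Num.sqrt n.+1%:R^-1.
  have e0 : 0 < (e%:C)%C by rewrite ltcR sqrtr_gt0 invr_gt0.
  have [_ [[g Ag ->] hg]] := cu _ (nbhsx_ballx u _ e0).
  exists g; split=> //; move: hg; rewrite -ball_normE/= rnormE ltcR.
  rewrite -(@ltr_pXn2r _ 2)// ?nnegrE ?rnorm_ge0 ?sqrtr_ge0//.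
  by rewrite sqr_sqrtr// invr_ge0.
have b0 : (fun n => 2 * n.+1%:R^-1) @ \oo --> (0 : R).
  rewrite -[X in _ --> X](mulr0 2); apply: cvgM; first exact: cvg_cst.
  exact: cvg_harmonic.
have dist m n : rnorm (A (g m) - A (g n)) ^+ 2 + rnorm (g m - g n) ^+ 2 <=
    2 * m.+1%:R^-1 + 2 * n.+1%:R^-1.
  have [Am um] := hg m; have [An un] := hg n.
  have [Amn AmnE] := linA.2 (-1) _ _ An Am.
  have -> : g m - g n = -1 *: g n + g m by rewrite scaleN1r addrC.
  have -> : A (g m) - A (g n) = A (-1 *: g n + g m).
    by rewrite AmnE scaleN1r addrC.
  rewrite -rnorm_symmetric_addi// AmnE.
  have := rnorm_parallelogram (u - (A (g n) + 'i *: g n))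
                              (u - (A (g m) + 'i *: g m)).
  have -> : u - (A (g n) + 'i *: g n) - (u - (A (g m) + 'i *: g m)) =
      -1 *: A (g n) + A (g m) + 'i *: (-1 *: g n + g m).
    rewrite subrBB opprD addrACA scalerDr !scaleN1r scalerN.
    by rewrite [- A _ + _]addrC [- (_ *: _) + _]addrC.
  move: um un; set v := _ + 'i *: (_ + _); set s := _ - _ + (_ - _).
  move: (u - _) (u - _) => p r.
  have : 0 <= rnorm s ^+ 2 by rewrite exprn_ge0 ?rnorm_ge0.
  set a := m.+1%:R^-1; set b := n.+1%:R^-1.
  by move: a b => a b *; lra.
have /cvg_ex[g' gg'] : cvgn g.
  apply: (cauchy_cvg_rnorm b0) => m n; apply: le_trans (dist m n).
  by rewrite lerDr exprn_ge0 ?rnorm_ge0.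
have /cvg_ex[h' hh'] : cvgn (A \o g).
  apply: (cauchy_cvg_rnorm b0) => m n; apply: le_trans (dist m n).
  by rewrite lerDl exprn_ge0 ?rnorm_ge0.
have [/= Ag' Ag'E] : dom A g' /\ A g' = h'.
  apply: (closed_cvg _ closedA _ (g', h') (cvg_pair gg' hh')).
  by apply: nearW => n /=; have [] := hg n.
exists g' => //; rewrite Ag'E.
have c1 : (fun n => A (g n) + 'i *: g n) @ \oo --> u.
  by apply: (cvg_rnorm cvg_harmonic) => n; apply: ltW; exact: (hg n).2.
have c2 : (fun n => A (g n) + 'i *: g n) @ \oo --> h' + 'i *: g'.
  by apply: cvgD => //; apply: cvgZr.
exact: (cvg_unique (@norm_hausdorff _ H) c1 c2).
Qed.

(** Projecting [adjoint A u + 'i *: u] on the range of [A + i] writes it as [(A + i) g + n] with [n]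
    in the deficiency space at [i]; a multiple of [n] then corrects [u - g] into the deficiency
    space at [- i]. *)
Theorem vonNeumann_decomposition u : Hplus A u ->
  exists g n m, [/\ dom A g, eigenspace (adjoint A) 'i n,
    eigenspace (adjoint A) (- 'i) m & u = g + n + m].
Proof.
move=> Au; have lin' := adjoint_linear denseA.
have [|_ [g Ag ->] orth] := orthogonal_projection
  (adjoint A u + 'i *: u) closed_range_addi _ range_addi_linear.
  by exists 0; rewrite ?linear_operator0 ?scaler0 ?addr0//; exact: linA.1.
move nE : (_ - _) orth => n orth.
have [An AnE] : dom (adjoint A) n /\ adjoint A n = 'i *: n.
  apply: adjointE => // f Af.
  have /orth : range_addi (A f + 'i *: f) by exists f.
  rewrite -(innerC _ n) => /(congr1 Num.conj); rewrite conjCK rmorph0 !innerE.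
  by move=> /eqP; rewrite addr_eq0 conjCi mulNr => /eqP.
have [A'g A'gE] := symA Ag.
(* [adjoint A + i] maps [u - g] to [n] and [c n] to [2 i c n], so it annihilates [c n + (u - g)]
   exactly when [c = i / 2]. *)
have [c hc] : exists c : C, c * 'i + 1 = - 'i * c.
  exists ('i / 2); rewrite mulrAC mulNr mulrA mulCii mulN1r opprK addrC.
  by rewrite {1}[1]splitr mul1r addrK.
have [Agu AguE] := lin'.2 (-1) _ _ A'g Au.
have [Am AmE] := lin'.2 c _ _ An Agu.
exists g, (- c *: n), (c *: n + (-1 *: g + u)); split => //.
- by have := linear_operatorZ (- c) lin' An; rewrite AnE scalerA mulrC -scalerA.
- split=> //; rewrite AmE AguE A'gE AnE.
  have -> : adjoint A u = n + (A g + 'i *: g) - 'i *: u.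
    by rewrite -nE subrK addrK.
  rewrite 2!scalerDr !scalerA -hc scalerDl scale1r.
  rewrite mulrN1 opprK scaleN1r scaleNr.
  by rewrite -!addrA; congr (_ + _); rewrite addrCA addKr.
- by rewrite scaleN1r scaleNr addrA subrK addNKr.
Qed.

End VonNeumann.

(** * Impedance and resolvent vectors *)

Section Impedance.
Context {R : realType} {H : hilbertSpace R}.
Local Notation C := R[i].
Local Notation "''(' f , g )" := (inner H f g) (format "''(' f ,  g )").
Implicit Types (f g h : H) (a z : C).

Variable A : operator H.
Hypotheses (denseA : densely_defined A).
Variable L : Lsystem A.

Local Notation T := (main_op L).
Local Notation S := (rigged_Re (state_op L)).
Local Notation chi := (channel_op L 1).
Local Notation phi := (channel_adjoint (channel_op L)).

Lemma HplusP a f g : Hplus A f -> Hplus A g -> Hplus A (a *: f + g).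
Proof. by move=> Af Ag; have [] := (adjoint_linear denseA).2 a f g Af Ag. Qed.

Lemma HplusZ a f : Hplus A f -> Hplus A (a *: f).
Proof.
by move=> Af; have [] := linear_operatorZ a (adjoint_linear denseA) Af.
Qed.

Lemma channelE a g : Hplus A g -> channel_op L a g = a * chi g.
Proof.
move=> Ag; have [_ lin _] := channel_bounded L.
have K0 : channel_op L 0 g = 0.
  have := lin 1 0 0 g Ag; rewrite mulr0 addr0 mul1r => /eqP.
  by rewrite -subr_eq subrr eq_sym => /eqP.
by have := lin a 1 0 g Ag; rewrite mulr1 addr0 K0 addr0.
Qed.

Lemma phiE f : phi f = (chi f)^*.
Proof. by []. Qed.

Lemma chiP a f g : Hplus A f -> Hplus A g ->
  chi (a *: f + g) = a^* * chi f + chi g.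
Proof.
by move=> *; have [/(_ 1)[lin _] _ _] := channel_bounded L; exact: lin.
Qed.

Lemma phiP a f g : Hplus A f -> Hplus A g ->
  phi (a *: f + g) = a * phi f + phi g.
Proof. by move=> Af Ag; rewrite !phiE chiP// rmorphD rmorphM/= conjCK. Qed.

Lemma phiZ a f : Hplus A f -> phi (a *: f) = a * phi f.
Proof.
move=> Af; have := phiP (-1) Af Af; rewrite scaleN1r addNr mulN1r addNr => phi0.
have := phiP a Af (adjoint_linear denseA).1.
by rewrite phi0 !addr0.
Qed.

Lemma state_split f g : Hplus A f -> Hplus A g ->
  state_op L f g = S f g + 'i * phi f * chi g.
Proof.
move=> Af Ag; rewrite -mulrA -channelE// -(state_Im L Af Ag).
rewrite /rigged_Re /rigged_Im; field.
by rewrite neq0Ci.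
Qed.

Lemma rigged_Re_conj f g : (S f g)^* = S g f.
Proof.
rewrite /rigged_Re /rigged_adjoint rmorphM rmorphD/= conjCK.
by rewrite fmorphV/= conjC_nat addrC.
Qed.

Lemma rigged_adjoint_split f g : Hplus A f -> Hplus A g ->
  rigged_adjoint (state_op L) f g = S f g - 'i * phi f * chi g.
Proof.
move=> Af Ag; rewrite /rigged_adjoint state_split// rmorphD/= rigged_Re_conj.
by rewrite !rmorphM/= conjCi conjCK !mulNr mulrAC.
Qed.

Lemma state_linear a f g h : Hplus A f -> Hplus A g -> Hplus A h ->
  state_op L (a *: f + g) h = a * state_op L f h + state_op L g h.
Proof.
by move=> Af Ag; have [[_ + _] _ _ _] := state_star_extension L; exact.
Qed.

Lemma rigged_Re_linear a f g h : Hplus A f -> Hplus A g -> Hplus A h ->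
  S (a *: f + g) h = a * S f h + S g h.
Proof.
move=> Af Ag Ah; have Afg := HplusP a Af Ag.
have := state_linear a Af Ag Ah; rewrite !state_split// phiP//.
by move=> e; apply: (addIr ('i * (a * phi f + phi g) * chi h)); rewrite e; ring.
Qed.

Lemma main_state f g : dom T f -> Hplus A g ->
  Hplus A f /\ state_op L f g = '(adjoint A f, g).
Proof.
move=> Tf Ag; have [_ [_ TB] _ _] := state_star_extension L.
have [Af ->//] := TB _ Tf.
by split=> //; rewrite /emb_Hminus ((main_between L).2 _ Tf).2.
Qed.

Lemma sym_Hplus g : dom A g -> Hplus A g.
Proof.
by move=> /((main_between L).1)[Tg _]; have [] := (main_between L).2 _ Tg.
Qed.

(** On [dom A] both [B] and its adjoint act as [A], so their difference [2 i phi(g) chi] vanishes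
    there. *)
Lemma phi_sym g h : dom A g -> Hplus A h -> phi g * chi h = 0.
Proof.
move=> Ag Ah; have A'g := sym_Hplus Ag.
have [Tg TgE] := (main_between L).1 _ Ag.
have [_ [_ TB] [AT T'B] _] := state_star_extension L.
have [T'g T'gE] := AT _ Ag.
have := (TB _ Tg).2 _ Ah; have := (T'B _ T'g).2 _ Ah.
rewrite /emb_Hminus TgE T'gE state_split// rigged_adjoint_split// => <- /eqP.
rewrite -subr_eq0 opprD opprK addrACA subrr add0r -mulrA -mulr2n mulrn_eq0/=.
by rewrite mulf_eq0 (negPf (neq0Ci _))/= => /eqP.
Qed.

(* [f] solves [(Re B - z I) f = K 1] in [Hminus]. *)
Definition resolvent_at z f : Prop :=
  Hplus A f /\ forall g, Hplus A g -> S f g - z * '(f, g) = chi g.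

(* Where the equation has no solution, [xget] makes [impedance] equal to [0]. *)
Lemma impedance_neq0 z : impedance L z != 0 ->
  exists2 f, resolvent_at z f & phi f = impedance L z.
Proof.
rewrite /impedance /rigged_resolvent; case: xgetP => [f _ [Af fE] _|_].
  by exists f.
by rewrite -(scale0r 0) phiZ ?mul0r ?eqxx//; exact: (adjoint_linear denseA).1.
Qed.

(** The form [S] is hermitian, so [S f f = z (f, f)] is real while [z] is not. This makes resolvent
    vectors at nonreal points unique. *)
Lemma rigged_Re_eigen z f : Hplus A f -> z^* != z ->
  (forall g, Hplus A g -> S f g = z * '(f, g)) -> f = 0.
Proof.
move=> Af z_nreal Sf; apply: inner_eq0; apply/eqP.
have := rigged_Re_conj f f; rewrite Sf// rmorphM/= innerC => /eqP.
by rewrite -subr_eq0 -mulrBl mulf_eq0 subr_eq0 (negPf z_nreal).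
Qed.

Lemma impedanceE z f : z^* != z -> resolvent_at z f -> impedance L z = phi f.
Proof.
move=> z_nreal [Af fE]; rewrite /impedance /rigged_resolvent; congr (phi _).
case: xgetP => [f' _ [Af' f'E]|/(_ f)]; last by case.
apply: subr0_eq; rewrite addrC -scaleN1r; apply: (rigged_Re_eigen _ z_nreal).
  exact: HplusP.
move=> g Ag; rewrite rigged_Re_linear// innerDl innerZl.
have := f'E g Ag; rewrite -(fE g Ag) => /eqP.
by rewrite subr_eq => /eqP ->; ring.
Qed.

(** From [B g = i g] follows [(S - i) g = - i phi(g) chi]. Here [phi(g)] is nonzero, as [S] has no
    eigenvector at [i]; hence [(i / phi(g)) g] is the resolvent vector, and [phi] takes the value
    [i] on it. *)
Lemma impedance_main g : eigenspace (adjoint A) 'i g -> g != 0 -> dom T g ->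
  impedance L 'i = 'i.
Proof.
move=> [Ag AgE] g0 Tg.
have i_nreal : ('i : C)^* != 'i.
  by rewrite conjCi -subr_eq0 -opprD oppr_eq0 -mulr2n mulrn_eq0 neq0Ci.
have Sg h : Hplus A h -> S g h + 'i * phi g * chi h = 'i * '(g, h).
  by move=> Ah; rewrite -state_split// (main_state Tg Ah).2 AgE innerZl.
have phig : phi g != 0.
  apply: contra_neq g0 => phig; apply: (rigged_Re_eigen Ag i_nreal) => h Ah.
  by rewrite -(Sg h Ah) phig mulr0 mul0r addr0.
rewrite (@impedanceE 'i ('i / phi g *: g))// ?phiZ ?divfK//.
split=> [|h Ah]; first exact: HplusZ.
rewrite -[_ *: g]addr0 rigged_Re_linear//; last first.
  exact: (adjoint_linear denseA).1.
have -> : S 0 h = 0.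
  have := rigged_Re_linear (-1) Ag Ag Ah.
  by rewrite scaleN1r addNr mulN1r addNr.
rewrite !addr0 innerZl; move/(canRL (addrK _)) : (Sg h Ah) => ->.
rewrite [LHS](_ : _ = - ('i * 'i) * chi h); last by field.
by rewrite mulCii opprK mul1r.
Qed.

(** The symmetry of [V] under conjugation: each equation is tested on the other solution, and [S] is
    hermitian. *)
Lemma resolvent_conj z f f' : resolvent_at z f -> resolvent_at z^* f' ->
  phi f' = (phi f)^*.
Proof.
move=> [Af fE] [Af' f'E]; rewrite phiE; congr (_^*).
rewrite -(fE _ Af') phiE -(f'E _ Af) rmorphB/= rigged_Re_conj.
by rewrite rmorphM/= conjCK innerC.
Qed.

(** Testing the equation on [f] itself and comparing with the conjugate eliminates the real number
    [S f f]. *)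
Lemma resolvent_norm z f : resolvent_at z f ->
  (z^* - z) * '(f, f) = (phi f)^* - phi f.
Proof.
move=> [Af fE]; rewrite phiE conjCK -(fE _ Af).
by rewrite rmorphB/= rigged_Re_conj rmorphM/= innerC; ring.
Qed.

Lemma phi_sym_eq0 g h : dom A g -> Hplus A h -> phi h != 0 -> phi g = 0.
Proof.
move=> Ag Ah phih; have /eqP := phi_sym Ag Ah.
rewrite -[chi h]conjCK -(phiE h) mulf_eq0 (conjC_eq0 (phi h)) (negPf phih).
by rewrite orbF => /eqP.
Qed.

(** For [g] in [dom A], [phi g = 0], so [S g] is [A g] and [chi g = 0]; the equation for [f] tested
    on [g] then becomes the adjoint relation. *)
Lemma resolvent_eigen z f : resolvent_at z f -> phi f != 0 ->
  eigenspace (adjoint A) z f.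
Proof.
move=> [Af fE] phif; apply: adjointE => // g Ag.
have A'g := sym_Hplus Ag; have [Tg TgE] := (main_between L).1 _ Ag.
have phig := phi_sym_eq0 Ag Af phif.
have := (main_state Tg Af).2.
rewrite ((main_between L).2 _ Tg).2 TgE => <-.
rewrite state_split// phig mulr0 mul0r addr0 -rigged_Re_conj innerZr.
have /eqP := fE g A'g; rewrite -[chi g]conjCK -(phiE g) phig rmorph0 subr_eq0.
by move=> /eqP ->; rewrite rmorphM/= innerC.
Qed.

Lemma state_resolvent z f h : resolvent_at z f -> Hplus A h ->
  state_op L f h = z * '(f, h) + (1 + 'i * phi f) * chi h.
Proof. by move=> [Af fE] Ah; rewrite state_split// -(fE h Ah); ring. Qed.

(** Otherwise [adjoint T] would map [f] to [z f], and so would the adjoint of [B], which extends it.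
    But the resolvent equation gives that adjoint the extra term [(1 - i phi(f)) chi], nonzero at
    [f]. *)
Lemma main_proper z f : resolvent_at z f -> phi f != 0 -> 'i * phi f != 1 ->
  exists u, dom T u /\ ~ dom A u.
Proof.
move=> zf phif phif1; apply: contrapT => /forallNP TA.
have {}TA u : dom T u -> dom A u.
  by move=> Tu; apply: contrapT => Au; exact: (TA u).
have denseT : densely_defined T.
  move=> O O0 Oo; have [x [Ox Ax]] := denseA O0 Oo.
  by exists x; split=> //; exact: ((main_between L).1 _ Ax).1.
have [A'f A'fE] := resolvent_eigen zf phif.
have [T'f T'fE] : dom (adjoint T) f /\ adjoint T f = z *: f.
  apply: adjointE => // u Tu; have Au := TA _ Tu.
  by rewrite ((main_between L).1 _ Au).2 -A'fE adjointP.
have [_ _ [_ T'B] _] := state_star_extension L.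
have := (T'B _ T'f).2 f A'f; rewrite /emb_Hminus T'fE innerZl.
rewrite rigged_adjoint_split//; have [_ /(_ f A'f)/eqP] := zf.
rewrite subr_eq => /eqP -> /eqP; rewrite -subr_eq0.
have -> : chi f + z * '(f, f) - 'i * phi f * chi f - z * '(f, f) =
  (1 - 'i * phi f) * chi f by ring.
rewrite mulf_eq0 subr_eq0 eq_sym (negPf phif1)/= => /eqP chif.
by move: phif; rewrite phiE chif rmorph0 eqxx.
Qed.

End Impedance.

(** * The dissipation coefficient *)

Lemma conj_real_complex (R : realType) (x : R) : ((x%:C)%C)^* = (x%:C)%C.
Proof. by rewrite conj_Creal// complex_real. Qed.

Lemma has_dim1_scale (R : realType) (H : hilbertSpace R) (V : set H) f g :
  has_dim V 1 -> V f -> f != 0 -> V g -> exists c : R[i], g = c *: f.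
Proof.
move=> [b [_ ->]] [a aE] f0 [c cE].
rewrite !big_ord1 in aE cE; exists (c ord0 / a ord0).
have a0 : a ord0 != 0.
  by apply: contra_neq f0; rewrite aE => ->; rewrite scale0r.
by rewrite aE cE scalerA divfK.
Qed.

Section Dissipation.
Context {R : realType} {H : hilbertSpace R}.
Local Notation C := R[i].
Local Notation "''(' f , g )" := (inner H f g) (format "''(' f ,  g )").
Implicit Types (f g h : H) (a z : C).

Variable A : operator H.
Hypotheses (linA : linear_operator A) (denseA : densely_defined A).
Hypotheses (closedA : closed_operator A) (symA : symmetric_operator A).
Hypotheses (defA : deficiency_indices A 1 1).
Variable L : Lsystem A.

Local Notation T := (main_op L).
Local Notation phi := (channel_adjoint (channel_op L)).

Variables (Q : R) (f f' : H).
Hypothesis Q0 : Q != 0.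
Local Notation q := (Q%:C)%C.
Hypotheses (fi : resolvent_at L 'i f) (phif : phi f = q + 'i).
Hypotheses (f'i : resolvent_at L (- 'i) f') (phif' : phi f' = q - 'i).

Let q0 : q != 0.
Proof. by rewrite (inj_eq (@complexI R) Q 0). Qed.

Let q_addi_neq0 (x y : R) : x != 0 -> (x%:C)%C + (y%:C)%C * 'i != 0 :> C.
Proof.
move=> x0; apply/eqP => /(congr1 (@complex.Re R)); rewrite -complexiE /=.
by rewrite mulr0 mul0r subr0 addr0 => /eqP; rewrite (negPf x0).
Qed.

Let phif0 : phi f != 0.
Proof. by have := @q_addi_neq0 Q 1 Q0; rewrite phif mul1r. Qed.

Let phif'0 : phi f' != 0.
Proof. by have := @q_addi_neq0 Q (-1) Q0; rewrite phif' rmorphN mulN1r. Qed.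

Let den0 : 2 + 'i * q != 0 :> C.
Proof.
have := @q_addi_neq0 2 Q; rewrite pnatr_eq0 => /(_ isT).
by rewrite rmorph_nat mulrC.
Qed.

Let eig_f : eigenspace (adjoint A) 'i f.
Proof. exact: (resolvent_eigen denseA fi phif0). Qed.

Let eig_f' : eigenspace (adjoint A) (- 'i) f'.
Proof. exact: (resolvent_eigen denseA f'i phif'0). Qed.

Let norm_f : '(f, f) = 1.
Proof.
have := resolvent_norm fi; rewrite phif rmorphD/= conj_real_complex conjCi.
have -> : q - 'i - (q + 'i) = (- 'i - 'i) * 1 by ring.
by apply/mulfI; rewrite -opprD oppr_eq0 -mulr2n mulrn_eq0/= neq0Ci.
Qed.

Let norm_f' : '(f', f') = 1.
Proof.
have := resolvent_norm f'i.
rewrite phif' rmorphB rmorphN/= conj_real_complex conjCi !opprK.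
have -> : q + 'i - (q - 'i) = ('i + 'i) * 1 by ring.
by apply/mulfI; rewrite -mulr2n mulrn_eq0/= neq0Ci.
Qed.

(** [B u] and [adjoint A u] are compared on the test vector [f]. All terms cancel but those in
    [chi f], which is nonzero; their coefficients are [1 + i phi(f) = i q] and
    [1 + i phi(f') = 2 + i q]. *)
Lemma main_coef g a b : dom A g -> dom T (a *: f + (b *: f' + g)) ->
  a * ('i * q) + b * (2 + 'i * q) = 0.
Proof.
move=> Ag Tu; have [[Af AfE] [Af' Af'E]] := (eig_f, eig_f').
have A'g := sym_Hplus L Ag; have [A'g' A'gE] := symA Ag.
have lin' := adjoint_linear denseA.
have Abg := HplusP denseA b Af' A'g.
have := (main_state Tu Af).2.
rewrite !state_linear// (state_resolvent fi Af) (state_resolvent f'i Af).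
rewrite (lin'.2 a _ _ Af Abg).2 (lin'.2 b _ _ Af' A'g).2 AfE Af'E A'gE.
rewrite (main_state ((main_between L).1 _ Ag).1 Af).2 A'gE !innerE phif phif'.
set X := '(f, f); set Y := '(f', f); set Z := '(A g, f).
set w := channel_op L 1 f.
have w0 : w != 0 by move: phif0; rewrite phiE conjC_eq0.
move/eqP; rewrite -subr_eq0 => /eqP e; apply: (mulIf w0); rewrite mul0r -[RHS]e.
rewrite !mulrDr mulCii mulrN mulCii; ring.
Qed.

(** A vector [u] of [dom T] outside [dom A] decomposes as [a f + b f' + g]. By [main_coef], [b = 0]
    would force [a = 0] and put [u] in [dom A]; so [b] and then [a] are nonzero, and [(u - g) / a]
    is the required vector. *)
Lemma main_basis : dom T (f - ('i * q / (2 + 'i * q)) *: f').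
Proof.
have phif1 : 'i * phi f != 1.
  have := @q_addi_neq0 (-2) Q; rewrite oppr_eq0 pnatr_eq0 => /(_ isT).
  apply: contra_neq; rewrite phif mulrDr mulCii => /(canRL (addrK _)).
  rewrite opprK mulrC => ->.
  by rewrite rmorphN rmorph_nat addrC subrr.
have [u [Tu nAu]] := main_proper denseA fi phif0 phif1.
have Au : Hplus A u by have [] := (main_between L).2 _ Tu.
have [g [n [m [Ag An Am uE]]]] :=
  vonNeumann_decomposition linA denseA closedA symA Au.
have nz h : '(h, h) = 1 -> h != 0.
  move=> h1; apply/eqP => h0; move/eqP: h1.
  by rewrite h0 inner0l eq_sym oner_eq0.
have [a aE] := has_dim1_scale defA.1 eig_f (nz _ norm_f) An.
have [b bE] := has_dim1_scale defA.2 eig_f' (nz _ norm_f') Am.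
have {}uE : u = a *: f + (b *: f' + g) by rewrite uE aE bE -addrA addrC addrA.
have := Tu; rewrite uE => /(main_coef Ag)/eqP.
have [b0|b0] := eqVneq b 0.
  rewrite b0 mul0r addr0 !mulf_eq0 (negPf q0) (negPf (neq0Ci _)) !orbF.
  move=> /eqP a0.
  by case: nAu; rewrite uE a0 b0 !scale0r !add0r.
move=> /eqP e.
have a0 : a != 0.
  apply: contra_neq b0 => a0; apply: (mulIf den0).
  by move: e; rewrite a0 !mul0r add0r.
have [Tg _] := (main_between L).1 _ Ag.
have [Tug _] := (main_linear L).2 (-1) _ _ Tg Tu.
have [+ _] := linear_operatorZ a^-1 (main_linear L) Tug.
rewrite uE scaleN1r [- g + _]addrC addrA addrK scalerDr !scalerA.
rewrite mulVf// scale1r.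
congr (dom T (f + _)); rewrite -scaleNr; congr (_ *: _).
apply: (mulIf den0); rewrite mulNr divfK//; apply: (mulfI a0).
rewrite !mulrA mulfV// mul1r mulrN; apply/eqP.
by rewrite -subr_eq0 opprK addrC e.
Qed.

(** [T y = i gp + i kappa gm]; the cross terms of [(T y, y)] are [i kappa] times a difference of
    conjugate numbers, hence real. *)
Lemma dissipationE (gp gm : H) (kappa : R) : deficiency_vectors A gp gm ->
  `|gp| = 1 -> `|gm| = 1 ->
  let y := gp - (kappa%:C)%C *: gm in
  dom T y -> complex.Im '(T y, y) = 1 - kappa ^+ 2.
Proof.
move=> [[Ap ApE] [Am AmE]] p1 m1 y Ty.
have [_ TyE] := (main_between L).2 _ Ty.
have lin' := adjoint_linear denseA.
rewrite -TyE /y addrC -scaleNr (lin'.2 _ _ _ Am Ap).2 ApE AmE !innerE.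
rewrite !inner_norm p1 m1 expr1n !mulr1 rmorphN/= conj_real_complex.
rewrite -(innerC gm gp); case: '(gm, gp) => s t; rewrite -complexiE /=.
by simpc; ring.
Qed.

Let sqr_norm_real (x : R) : `|(x%:C)%C| ^+ 2 = ((x ^+ 2)%:C)%C :> C.
Proof. by rewrite normCK conj_real_complex -rmorphM. Qed.

Let sqr_norm_den : `|2 + 'i * q| ^+ 2 = ((Q ^+ 2 + 4)%:C)%C :> C.
Proof.
rewrite normCK rmorphD/= rmorphM/= conj_real_complex conjCi conjC_nat.
rewrite rmorphD rmorphXn/= rmorph_nat.
rewrite [LHS](_ : _ = q ^+ 2 * - ('i * 'i) + 4); last by ring.
by rewrite mulCii opprK mulr1.
Qed.

(** [c] and [d] stand for the unimodular factors between [f], [f'] and another normalized deficiency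
    basis; taking moduli removes them. *)
Lemma kappa_sqr (kappa : R) (c d : C) : `|c| = 1 -> `|d| = 1 ->
  c * ('i * q) = (kappa%:C)%C * d * (2 + 'i * q) ->
  Q ^+ 2 = kappa ^+ 2 * (Q ^+ 2 + 4).
Proof.
move=> c1 d1 /(congr1 (fun x => `|x| ^+ 2)).
rewrite !normrM !exprMn c1 d1 normCi !expr1n !mul1r mulr1.
rewrite sqr_norm_den !sqr_norm_real -rmorphM/=; exact: complexI.
Qed.

Lemma norm_scale1 (g h : H) c : `|g| = 1 -> `|h| = 1 -> h = c *: g -> `|c| = 1.
Proof. by move=> g1 h1 /(congr1 Num.norm); rewrite normrZ g1 h1 mulr1. Qed.

Lemma inner_norm1 (h : H) : '(h, h) = 1 -> `|h| = 1.
Proof.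
by rewrite inner_norm => /eqP; rewrite sqrp_eq1// => /eqP.
Qed.

Lemma dissipation_coefficient_iff (D : R) :
  dissipation_coefficient L D <-> D = 4 / (Q ^+ 2 + 4).
Proof.
have f1 := inner_norm1 norm_f; have f'1 := inner_norm1 norm_f'.
have nz h : `|h| = 1 -> h != 0 by move=> h1; rewrite -normr_eq0 h1 oner_eq0.
have Q4 : 0 < Q ^+ 2 + 4 by rewrite ltr_wpDl ?sqr_ge0.
have DE (kappa : R) : Q ^+ 2 = kappa ^+ 2 * (Q ^+ 2 + 4) ->
    1 - kappa ^+ 2 = 4 / (Q ^+ 2 + 4).
  move=> e; apply: (mulIf (lt0r_neq0 Q4)); rewrite divfK ?lt0r_neq0//.
  by rewrite mulrBl -e mul1r addrAC subrr add0r.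
split.
  move=> [gp [gm [kappa [[p1 m1] [eig _ _ Ty] _ ->]]]].
  rewrite (dissipationE eig p1 m1 Ty); apply: DE.
  have [c cE] := has_dim1_scale defA.1 eig_f (nz _ f1) eig.1.
  have [d dE] := has_dim1_scale defA.2 eig_f' (nz _ f'1) eig.2.
  apply: (@kappa_sqr kappa c d).
  - exact: norm_scale1 f1 p1 cE.
  - exact: norm_scale1 f'1 m1 dE.
  (* [main_coef] is applied with zero component in [dom A]. *)
  have A0 : dom A 0 by exact: linA.1.
  have := @main_coef 0 c (- ((kappa%:C)%C * d)) A0.
  rewrite addr0 scaleNr -scalerA -dE -cE => /(_ Ty)/eqP.
  by rewrite mulNr subr_eq0 => /eqP.
move=> ->.
pose kappa := Num.sqrt (Q ^+ 2 / (Q ^+ 2 + 4)).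
pose lambda : C := 'i * q / (2 + 'i * q).
have k2 : Q ^+ 2 = kappa ^+ 2 * (Q ^+ 2 + 4).
  by rewrite sqr_sqrtr ?divfK ?lt0r_neq0// divr_ge0 ?sqr_ge0 ?ltW.
have k0 : 0 < kappa by rewrite sqrtr_gt0 divr_gt0// exprn_even_gt0.
have kC : (kappa%:C)%C != 0 :> C by rewrite gt_eqF// ltcR.
(* The phase of [lambda] is absorbed into the basis vector, so that the parameter becomes the
   positive number [kappa], the modulus of [lambda]. *)
pose gm : H := (lambda / (kappa%:C)%C) *: f'.
have lambdaE : `|lambda| = (kappa%:C)%C.
  apply/eqP; rewrite -(@eqrXn2 _ 2)// ?ler0c ?ltW//; apply/eqP.
  rewrite normf_div normrM normCi mul1r expr_div_n sqr_norm_real sqr_norm_den.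
  rewrite {1}k2 -rmorphXn/= rmorphM/= mulfK//.
  by rewrite gt_eqF// ltcR.
have m1 : `|gm| = 1.
  rewrite /gm normrZ f'1 mulr1 normf_div lambdaE ger0_norm ?ler0c ?ltW//.
  by rewrite divff.
have yE : f - (kappa%:C)%C *: gm = f - lambda *: f'.
  by rewrite /gm scalerA mulrC divfK.
have eigm : eigenspace (adjoint A) (- 'i) gm.
  have [A'm A'mE] := eig_f'.
  have [Am AmE] :=
    linear_operatorZ (lambda / (kappa%:C)%C) (adjoint_linear denseA) A'm.
  by split=> //; rewrite AmE A'mE !scalerA mulrC.
have Ty : dom T (f - (kappa%:C)%C *: gm) by rewrite yE; exact: main_basis.
exists f, gm, kappa; split=> //.
- by split=> //; [exact: nz|rewrite f1 m1].
- rewrite (ltW k0)/= -(@ler_pXn2r _ 2)// ?nnegrE ?(ltW k0)// expr1n.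
  by rewrite -subr_ge0 DE// divr_ge0// ltW.
- by rewrite (dissipationE _ f1 m1 Ty)// DE.
Qed.

End Dissipation.

Theorem theorem10 (R : realType) (H : hilbertSpace R) (A : operator H)
    (linA : linear_operator A) (denseA : densely_defined A)
    (closedA : closed_operator A) (symA : symmetric_operator A)
    (defA : deficiency_indices A 1 1)
    (gp gm : H) (defg : deficiency_vectors A gp gm)
    (normgp : norm_plus A gp = 1) (normgm : norm_plus A gm = 1)
    (Theta : Lsystem A)
    (nsaT : ~ opeq (main_op Theta) (adjoint (main_op Theta)))
    (maxT : maximal_dissipative (main_op Theta))
    (gpT : dom (main_op Theta) gp)
    (gA : dom (state_quasi_kernel Theta) (gp - gm) \/
          dom (state_quasi_kernel Theta) (gp + gm))
    (Q : R) (Q0 : Q != 0)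
    (ThetaQ : Lsystem A) (pertQ : perturbation Theta Q ThetaQ) :
  forall D : R, dissipation_coefficient ThetaQ D <-> D = 4 / (Q ^+ 2 + 4).
Proof.
have gp0 : gp != 0.
  have lin' := adjoint_linear denseA.
  apply/eqP => gp0; move: normgp; rewrite gp0 /norm_plus /inner_plus.
  rewrite linear_operator0// inner0l addr0 sqrtC0 => /eqP.
  by rewrite eq_sym oner_eq0.
have i_nreal : complex.Im ('i : R[i]) != 0 by rewrite -complexiE oner_eq0.
have Ni_nreal : complex.Im (- 'i : R[i]) != 0.
  by rewrite -complexiE oppr_eq0 oner_eq0.
have Vi : impedance Theta 'i = 'i by exact: impedance_main defg.1 gp0 gpT.
have ViQ := pertQ _ i_nreal; have VNiQ := pertQ _ Ni_nreal; rewrite Vi in ViQ.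
set q := (Q%:C)%C in ViQ VNiQ.
have q0 : q != 0 by rewrite (inj_eq (@complexI R) Q 0).
(* A nonzero impedance value is not the default one, so it comes from an actual resolvent vector. *)
have qi0 : q + 'i != 0.
  apply/eqP => /(congr1 (@complex.Re R)).
  by rewrite -complexiE /= addr0; apply/eqP.
have [|f fi phif] := @impedance_neq0 _ _ _ denseA ThetaQ 'i.
  by rewrite ViQ.
rewrite ViQ in phif.
have Nineq : q != q - 'i.
  by rewrite eq_sym -subr_eq0 addrAC subrr add0r oppr_eq0 neq0Ci.
(* Were [- i] a point where the equation for [Theta] is not solvable, the junk
   value [V(-i) = 0] would give [V_Q(-i) = Q], but [V_Q(-i)] is the conjugate of
   [V_Q(i) = Q + i]. *)
have VNi : impedance Theta (- 'i) = - 'i.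
  have [VNi0|VNi0] := eqVneq (impedance Theta (- 'i)) 0.
    rewrite VNi0 addr0 in VNiQ.
    have [|f' f'i phif'] := @impedance_neq0 _ _ _ denseA ThetaQ (- 'i).
      by rewrite VNiQ.
    rewrite -conjCi in f'i; move: (resolvent_conj fi f'i) Nineq.
    rewrite phif' phif VNiQ rmorphD/= conj_real_complex conjCi => {1}->.
    by rewrite eqxx.
  (* Here both values of [V] come from actual resolvent vectors, and conjugation symmetry
     applies. *)
  have [|g gi phig] := @impedance_neq0 _ _ _ denseA Theta 'i.
    by rewrite Vi neq0Ci.
  have [g' g'i <-] := impedance_neq0 denseA VNi0.
  rewrite -conjCi in g'i.
  by rewrite (resolvent_conj gi g'i) phig Vi conjCi.
rewrite VNi in VNiQ.
have [|f' f'i phif'] := @impedance_neq0 _ _ _ denseA ThetaQ (- 'i).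
  rewrite VNiQ; apply/eqP => /(congr1 (@complex.Re R)).
  by rewrite -complexiE /= oppr0 addr0; apply/eqP.
rewrite VNiQ in phif'.
move=> D; exact: (dissipation_coefficient_iff linA denseA closedA symA defA Q0
  fi phif f'i phif').
Qed.
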